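(* No 2-generic set $X$ can compute an infinite set which is indifferent for $X$ with respect to weak 1-genericity.
   Context: A set $X\subseteq\mathbb{N}$ is weakly 1-generic if it meets every dense c.e. set of binary strings (has a prefix in it). $X$ is 2-generic if for every $\Sigma^0_2$ set $S$ of strings, some prefix of $X$ is in $S$ or has no extension in $S$. A set $I$ is indifferent for $X$ with respect to weak 1-genericity if every $Y$ with $Y(n)=X(n)$ for all $n\notin I$ is weakly 1-generic. *)

(* Defs.v *)
From mathcomp Require Import all_boot.
From mathcomp Require Import boolp classical_sets cardinality.

Set Implicit Arguments.
Unset Strict Implicit.
Unset Printing Implicit Defensive.

Local Open Scope classical_set_scope.

(* Kleene's schemes for the functions that are partial recursive relative to
   an oracle. Programs are not indexed by their arity: arguments are passed as
   a list, and [Zero], [Succ], [Proj] and [Oracle] read a missing argument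
   as 0. *)
Inductive prog : Type :=
  | Zero
  | Succ
  | Proj of nat
  | Oracle
  | Comp of prog & seq prog
  | PrimRec of prog & prog
  | Mu of prog.

(* [eval A c v y]: the program [c] with oracle [A] halts on the arguments [v]
   with output [y]. In [eval_mu], [y] is the least zero of [f (-, v)], and
   [f (z, v)] has to converge for every [z < y]. *)
Inductive eval (A : nat -> bool) : prog -> seq nat -> nat -> Prop :=
  | eval_zero v : eval A Zero v 0
  | eval_succ v : eval A Succ v (nth 0 v 0).+1
  | eval_proj i v : eval A (Proj i) v (nth 0 v i)
  | eval_oracle v : eval A Oracle v (A (nth 0 v 0))
  | eval_comp f gs v ws y :
      size ws = size gs ->
      (forall i, i < size gs -> eval A (nth Zero gs i) v (nth 0 ws i)) ->
      eval A f ws y ->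
      eval A (Comp f gs) v y
  | eval_rec0 f g v y :
      eval A f v y ->
      eval A (PrimRec f g) (0 :: v) y
  | eval_recS f g n v r y :
      eval A (PrimRec f g) (n :: v) r ->
      eval A g [:: n, r & v] y ->
      eval A (PrimRec f g) (n.+1 :: v) y
  | eval_mu f v y (w : nat -> nat) :
      (forall z, z < y -> eval A f (z :: v) (w z).+1) ->
      eval A f (y :: v) 0 ->
      eval A (Mu f) v y.

(* Subsets of nat are identified with their characteristic functions. *)
Definition computes (X I : nat -> bool) : Prop :=
  exists c, forall n, eval X c [:: n] (I n).

(* Absolute computability is computability relative to the empty oracle. *)
Definition computable_rel3 (R : nat -> nat -> nat -> bool) : Prop :=
  exists c, forall a x y, eval (fun=> false) c [:: a; x; y] (R a x y).

(* Bijective base-2 numeration, least significant digit first: a bijection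
   between binary strings and nat. *)
Fixpoint strcode (s : seq bool) : nat :=
  if s is b :: s' then (strcode s').*2 + b.+1 else 0.

Definition ce (S : set (seq bool)) : Prop :=
  exists c, forall s,
    S s <-> exists y, eval (fun=> false) c [:: strcode s] y.

Definition sigma02 (S : set (seq bool)) : Prop :=
  exists2 R, computable_rel3 R &
    forall s, S s <-> exists x, forall y, R (strcode s) x y.

Definition dense_strings (S : set (seq bool)) : Prop :=
  forall s, exists2 t, prefix s t & S t.

(* [mkseq X n] is the prefix of [X] of length [n]. *)
Definition weakly_1_generic (X : nat -> bool) : Prop :=
  forall S, ce S -> dense_strings S -> exists n, S (mkseq X n).

Definition two_generic (X : nat -> bool) : Prop :=
  forall S, sigma02 S ->
    exists n, S (mkseq X n) \/
              (forall t, prefix (mkseq X n) t -> ~ S t).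

Definition indifferent_w1g (I X : nat -> bool) : Prop :=
  forall Y : nat -> bool,
    (forall n, ~~ I n -> Y n = X n) -> weakly_1_generic Y.

(* Main.v *)
(** Fix a program [c] computing the infinite set [I] from [X]. The strings that
    force [c] to produce no element beyond some bound form a [sigma02] set
    which [X] does not meet, so some prefix [s0] of [X] has no extension in it:
    every extension of [s0] has further extensions on which [c] produces
    arbitrarily large elements. Hence one computes consecutive blocks of
    positions, and for each of them a string [t], such that for every string
    [u] leading from the end of [s0] to the beginning of the block, [c] produces
    an element of the block on the oracle [s0 ++ u ++ t] (treat the finitely
    many [u] one after the other, extending [t] each time). The strings ending
    with the block string of some block form a dense c.e. set. Let [Y] take the
    values opposite to the block strings on [I] and agree with [X] elsewhere.
    If [Y] agreed with the string [t] of some block, then [I] would avoid the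
    block, so [X] would agree with [t] there, so [I] would contain an element
    of the block. Hence [Y] is not weakly 1-generic. *)

Require Import Defs.
From mathcomp Require Import all_boot.
From mathcomp Require Import boolp classical_sets cardinality.
From mathcomp Require Import zify.

Set Implicit Arguments.
Unset Strict Implicit.
Unset Printing Implicit Defensive.

Local Open Scope classical_set_scope.

(** * Closure properties of the recursive functions of fixed arity *)

(** Values on lists of other lengths are unconstrained, so functions can be written as list
    expressions such as [nth 0 v 1]. Predicates are included through the coercion from [bool] to
    [nat]. *)
Definition recursive k (f : seq nat -> nat) : Prop :=
  exists c, forall v, size v = k -> eval (fun=> false) c v (f v).

(** One program per output coordinate: the form in which [Comp] takes its inner functions. *)
Definition vrecursive k m (H : seq nat -> seq nat) : Prop :=
  exists2 gs, size gs = m & forall v, size v = k ->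
    size (H v) = m /\
    forall i, i < m -> eval (fun=> false) (nth Zero gs i) v (nth 0 (H v) i).

Lemma recursive_ext k f g :
  (forall v, size v = k -> g v = f v) -> recursive k f -> recursive k g.
Proof. by move=> fg [c cf]; exists c => v sv; rewrite fg //; apply: cf. Qed.

Lemma vrecursive_ext k m H H' :
  (forall v, size v = k -> H' v = H v) -> vrecursive k m H -> vrecursive k m H'.
Proof.
by move=> HH' [gs sgs gsH]; exists gs => // v sv; rewrite HH' //; apply: gsH.
Qed.

Lemma recursive_comp k m F H :
  vrecursive k m H -> recursive m F -> recursive k (fun v => F (H v)).
Proof.
move=> [gs sgs gsH] [c cF]; exists (Comp c gs) => v sv.
have [sH evH] := gsH v sv.
by apply: (@eval_comp _ _ _ _ (H v)); rewrite ?sgs //; apply: cF.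
Qed.

Lemma vrecursive_nil k : vrecursive k 0 (fun=> [::]).
Proof. by exists [::]. Qed.

Lemma vrecursive_cons k m h H :
  recursive k h -> vrecursive k m H -> vrecursive k m.+1 (fun v => h v :: H v).
Proof.
move=> [c ch] [gs sgs gsH]; exists (c :: gs); first by rewrite /= sgs.
move=> v sv; have [sH evH] := gsH v sv; split; first by rewrite /= sH.
by case=> [|i] im; [apply: ch | apply: evH].
Qed.

Lemma vrecursive_behead k m H :
  vrecursive k m H -> vrecursive k m.-1 (fun v => behead (H v)).
Proof.
move=> [gs sgs gsH]; exists (behead gs); first by rewrite size_behead sgs.
move=> v sv; have [sH evH] := gsH v sv; split; first by rewrite size_behead sH.
by move=> i im; rewrite !nth_behead; apply: evH; lia.
Qed.

Lemma vrecursive_drop k r : vrecursive (r + k) k (drop r).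
Proof.
exists [seq Proj i | i <- iota r k]; first by rewrite size_map size_iota.
move=> v sv; split; first by rewrite size_drop sv addKn.
move=> i ik; rewrite (nth_map 0) ?size_iota // nth_iota // nth_drop.
exact: eval_proj.
Qed.

Lemma vrecursive_id k : vrecursive k k id.
Proof.
apply: vrecursive_ext (@vrecursive_drop k 0) => v _.
by rewrite drop0.
Qed.

Lemma vrecursive_comp k m n G H :
  vrecursive k m H -> vrecursive m n G -> vrecursive k n (fun v => G (H v)).
Proof.
move=> [gs sgs gsH] [fs sfs fsG]; exists [seq Comp f gs | f <- fs].
  by rewrite size_map.
move=> v sv; have [sH evH] := gsH v sv; have [sG evG] := fsG _ sH.
split=> // i im; rewrite (nth_map Zero) ?sfs //.
by apply: (@eval_comp _ _ _ _ (H v)); rewrite ?sgs //; apply: evG.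
Qed.

Lemma recursive_drop k r f :
  recursive k f -> recursive (r + k) (fun v => f (drop r v)).
Proof. exact: recursive_comp (vrecursive_drop k r). Qed.

Lemma recursive_zero k : recursive k (fun=> 0).
Proof. by exists Zero => v _; apply: eval_zero. Qed.

Lemma recursive_nth k i : recursive k (fun v => nth 0 v i).
Proof. by exists (Proj i) => v _; apply: eval_proj. Qed.

Lemma vrecursive_nth k m H i :
  vrecursive k m H -> recursive k (fun v => nth 0 (H v) i).
Proof. by move=> rH; exact: (recursive_comp rH (recursive_nth m i)). Qed.

Lemma recursive1 F k f :
  recursive 1 (fun v => F (nth 0 v 0)) ->
  recursive k f -> recursive k (fun v => F (f v)).
Proof.
move=> rF rf; apply: (recursive_comp (H := fun v => [:: f v]) _ rF).
by apply: vrecursive_cons => //; apply: vrecursive_nil.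
Qed.

Lemma recursive3 F k f g h :
  recursive 3 (fun v => F (nth 0 v 0) (nth 0 v 1) (nth 0 v 2)) ->
  recursive k f -> recursive k g -> recursive k h ->
  recursive k (fun v => F (f v) (g v) (h v)).
Proof.
move=> rF rf rg rh.
apply: (recursive_comp (H := fun v => [:: f v; g v; h v]) _ rF).
by do 3!apply: vrecursive_cons => //; apply: vrecursive_nil.
Qed.

Lemma recursive_succ k f : recursive k f -> recursive k (fun v => (f v).+1).
Proof.
by apply: (@recursive1 succn); exists Succ => v _; apply: eval_succ.
Qed.

Lemma recursive_const k n : recursive k (fun=> n).
Proof.
by elim: n => [|n]; [apply: recursive_zero | apply: recursive_succ].
Qed.

Lemma recursive_rec k h f G :
  recursive k h -> recursive k f ->
  recursive k.+2 (fun v => G (nth 0 v 0) (nth 0 v 1) (drop 2 v)) ->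
  recursive k (fun v => nat_rec (fun=> nat) (f v) (fun n r => G n r v) (h v)).
Proof.
move=> rh [cf evf] [cg evg].
(* [PrimRec] recurses on the head of its argument list, so the count [h v] is put in front of the
   parameters. *)
apply: (@recursive_comp k k.+1
  (fun w => nat_rec (fun=> nat) (f (behead w))
    (fun n r => G n r (behead w)) (nth 0 w 0)) (fun v => h v :: v)).
- by apply: vrecursive_cons => //; apply: vrecursive_id.
- exists (PrimRec cf cg) => -[//|n v] [sv] /=.
  elim: n => [|n IHn] /=; first by apply: eval_rec0; apply: evf.
  apply: eval_recS IHn _.
  have := evg [:: n, nat_rec (fun=> nat) (f v) (fun n r => G n r v) n & v].
  by rewrite /= drop0 sv; apply.
Qed.

(** Case analysis is a primitive recursion whose step ignores the previous value; the rest of the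
    proof removes that value from the argument list. *)
Lemma recursive_case k h f G :
  recursive k h -> recursive k f ->
  recursive k.+1 (fun v => G (nth 0 v 0) (drop 1 v)) ->
  recursive k (fun v => if h v is n.+1 then G n v else f v).
Proof.
move=> rh rf rG.
apply: (@recursive_ext _
  (fun v => nat_rec (fun=> nat) (f v) (fun n _ => G n v) (h v))).
  by move=> v _; case: (h v).
apply: (recursive_rec (G := fun n _ => G n)) => //.
apply: (@recursive_ext _ (fun v => G (nth 0 (nth 0 v 0 :: drop 2 v) 0)
                                    (drop 1 (nth 0 v 0 :: drop 2 v)))).
  by move=> v _; rewrite /= drop0.
apply: (@recursive_comp _ k.+1
  (fun v => G (nth 0 v 0) (drop 1 v)) (fun v => nth 0 v 0 :: drop 2 v)) => //.
apply: vrecursive_cons; first exact: recursive_nth.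
exact: (@vrecursive_drop k 2).
Qed.

Lemma recursive_if k (b : seq nat -> bool) f g :
  recursive k b -> recursive k f -> recursive k g ->
  recursive k (fun v => if b v then f v else g v).
Proof.
move=> rb rf rg.
apply: (@recursive_ext _ (fun v => if b v : nat is n.+1 then f v else g v)).
  by move=> v _; case: (b v).
by apply: (recursive_case (G := fun=> f)) => //; apply: (@recursive_drop _ 1).
Qed.

Lemma recursive_pred k f : recursive k f -> recursive k (fun v => (f v).-1).
Proof.
move=> rf; apply: (@recursive_ext _ (fun v => if f v is n.+1 then n else 0)).
  by move=> v _; case: (f v).
apply: (recursive_case (G := fun n _ => n)) => //.
- exact: recursive_zero.
- exact: recursive_nth.
Qed.

Lemma recursive_iter F k h f :
  recursive 1 (fun v => F (nth 0 v 0)) ->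
  recursive k h -> recursive k f -> recursive k (fun v => iter (h v) F (f v)).
Proof.
move=> rF rh rf.
apply: (@recursive_ext _
  (fun v => nat_rec (fun=> nat) (f v) (fun _ r => F r) (h v))).
  by move=> v _; elim: (h v) => //= n ->.
apply: (recursive_rec (G := fun _ r _ => F r)) => //.
by apply: (@recursive1 F) => //; apply: recursive_nth.
Qed.

Lemma recursive_add k f g :
  recursive k f -> recursive k g -> recursive k (fun v => f v + g v).
Proof.
move=> rf rg; apply: (@recursive_ext _ (fun v => iter (f v) succn (g v))).
  by move=> v _; rewrite iter_succn addnC.
by apply: recursive_iter => //; apply: recursive_succ; apply: recursive_nth.
Qed.

Lemma recursive_sub k f g :
  recursive k f -> recursive k g -> recursive k (fun v => f v - g v).
Proof.
move=> rf rg; apply: (@recursive_ext _ (fun v => iter (g v) predn (f v))).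
  by move=> v _; elim: (g v) => [|n IHn]; rewrite ?subn0 // subnS IHn.
by apply: recursive_iter => //; apply: recursive_pred; apply: recursive_nth.
Qed.

Lemma recursive_mul k f g :
  recursive k f -> recursive k g -> recursive k (fun v => f v * g v).
Proof.
move=> rf rg; apply: (@recursive_ext _
  (fun v => nat_rec (fun=> nat) 0 (fun _ r => r + g v) (f v))).
  by move=> v _; elim: (f v) => //= n <-; rewrite mulSnr.
apply: (recursive_rec (G := fun _ r v => r + g v)) => //.
- exact: recursive_zero.
- apply: recursive_add; first exact: recursive_nth.
  exact: (@recursive_drop _ 2).
Qed.

Lemma recursive_exp2 k f : recursive k f -> recursive k (fun v => 2 ^ f v).
Proof.
move=> rf; apply: (@recursive_ext _ (fun v => iter (f v) (muln 2) 1)).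
  by move=> v _; elim: (f v) => //= n <-; rewrite expnS.
apply: recursive_iter => //; last exact: recursive_const.
by apply: recursive_mul; [apply: recursive_const | apply: recursive_nth].
Qed.

Lemma recursive_negb k (b : seq nat -> bool) :
  recursive k b -> recursive k (fun v => ~~ b v).
Proof.
move=> rb; apply: (@recursive_ext _ (fun v => if b v then 0 else 1)).
  by move=> v _; case: (b v).
by apply: recursive_if => //; apply: recursive_const.
Qed.

Lemma recursive_andb k (b1 b2 : seq nat -> bool) :
  recursive k b1 -> recursive k b2 -> recursive k (fun v => b1 v && b2 v).
Proof.
move=> r1 r2; apply: (@recursive_ext _ (fun v => b1 v * b2 v)).
  by move=> v _; rewrite mulnb.
exact: recursive_mul.
Qed.

Lemma recursive_leq k f g :
  recursive k f -> recursive k g -> recursive k (fun v => f v <= g v).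
Proof.
move=> rf rg.
apply: (@recursive_ext _ (fun v => if f v - g v is n.+1 then 0 else 1)).
  by move=> v _; rewrite /leq; case: (f v - g v).
apply: (recursive_case (G := fun _ _ => 0)); first exact: recursive_sub.
- exact: recursive_const.
- exact: recursive_const.
Qed.

Lemma recursive_eq k f g :
  recursive k f -> recursive k g -> recursive k (fun v => f v == g v).
Proof.
move=> rf rg.
apply: (@recursive_ext _ (fun v => (f v <= g v) && (g v <= f v))).
  by move=> v _; rewrite eqn_leq.
by apply: recursive_andb; apply: recursive_leq.
Qed.

Lemma recursive_odd k f : recursive k f -> recursive k (fun v => odd (f v)).
Proof.
(* The map [subn 1] swaps [0] and [1]. *)
move=> rf; apply: (@recursive_ext _ (fun v => iter (f v) (subn 1) 0)).
  by move=> v _; elim: (f v) => //= n <-; case: odd.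
apply: recursive_iter => //; last exact: recursive_const.
by apply: recursive_sub; [apply: recursive_const | apply: recursive_nth].
Qed.

Lemma recursive_half k f : recursive k f -> recursive k (fun v => (f v)./2).
Proof.
(* The recursion is [n.+1./2 = n - n./2]. *)
move=> rf; apply: (@recursive_ext _
  (fun v => nat_rec (fun=> nat) 0 (fun n r => n - r) (f v))).
  by move=> v _; elim: (f v) => //= n <-; rewrite uphalf_half; lia.
apply: (recursive_rec (G := fun n r _ => n - r)) => //.
- exact: recursive_zero.
- by apply: recursive_sub; apply: recursive_nth.
Qed.

Lemma recursive_all k (p : nat -> seq nat -> bool) h :
  recursive k.+1 (fun v => p (nth 0 v 0) (drop 1 v)) -> recursive k h ->
  recursive k (fun v => all (p^~ v) (iota 0 (h v))).
Proof.
move=> rp rh; apply: (@recursive_ext _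
  (fun v => nat_rec (fun=> nat) 1 (fun i r => r * p i v) (h v))).
  move=> v _; elim: (h v) => // n IHn.
  by rewrite -[in LHS]addn1 iotaD all_cat /= andbT -mulnb IHn.
apply: (recursive_rec (G := fun i r v => r * p i v)) => //.
- exact: recursive_const.
- apply: recursive_mul; first exact: recursive_nth.
  apply: (@recursive_ext _ (fun v => p (nth 0 (nth 0 v 0 :: drop 2 v) 0)
                                      (drop 1 (nth 0 v 0 :: drop 2 v)))).
    by move=> v _; rewrite /= drop0.
  apply: (@recursive_comp _ k.+1
    (fun v => p (nth 0 v 0) (drop 1 v)) (fun v => nth 0 v 0 :: drop 2 v)) => //.
  apply: vrecursive_cons; first exact: recursive_nth.
  exact: (@vrecursive_drop k 2).
Qed.

Lemma recursive_has k (p : nat -> seq nat -> bool) h :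
  recursive k.+1 (fun v => p (nth 0 v 0) (drop 1 v)) -> recursive k h ->
  recursive k (fun v => has (p^~ v) (iota 0 (h v))).
Proof.
move=> rp rh; apply: (@recursive_ext _
  (fun v => ~~ all (fun i => ~~ p i v) (iota 0 (h v)))).
  by move=> v _; rewrite -has_predC; congr nat_of_bool; apply: eq_has => i /=;
    rewrite negbK.
apply: recursive_negb; apply: (@recursive_all _ (fun i v => ~~ p i v)) => //.
exact: recursive_negb.
Qed.

Lemma recursive_mu k (p : nat -> seq nat -> bool) g :
  recursive k.+1 (fun v => p (nth 0 v 0) (drop 1 v)) ->
  (forall v, p (g v) v) -> (forall v y, p y v -> g v <= y) -> recursive k g.
Proof.
move=> /recursive_negb[c ev] pg gmin; exists (Mu c) => v sv.
have {}ev z : eval (fun=> false) c (z :: v) (~~ p z v).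
  by have := ev (z :: v); rewrite /= drop0; apply; rewrite sv.
(* [Mu] looks for a zero, hence the negation of [p]; before the least zero the negation has value
   [1], which is the successor of [0]. *)
apply: (@eval_mu _ _ _ _ (fun=> 0)) => [z zg|].
  have -> : 1 = (~~ p z v) by case: (boolP (p z v)) => // /gmin; lia.
  exact: ev.
by have := ev (g v); rewrite pg.
Qed.

(** * Arithmetic on the codes of binary strings *)

Definition code_behead n := n.-1./2.
Definition code_drop i n := iter i code_behead n.
(** The digit of [b] is [b.+1], so the code of a nonempty string is even exactly when its first bit
    is [true]. Past the end the remaining code is [0], and the bit reads [true]. *)
Definition code_bit n i := ~~ odd (code_drop i n).
(** The codes of the strings of length [k] run from [2 ^ k - 1] to [2 ^ k.+1 - 2]. *)
Definition code_size n := trunc_log 2 n.+1.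

Lemma strcode_drop s i : code_drop i (strcode s) = strcode (drop i s).
Proof.
elim: i s => [|i IHi] s; first by rewrite drop0.
rewrite /code_drop iterSr -/(code_drop _ _); case: s => [|b s] /=.
  by rewrite (IHi [::]).
by rewrite -IHi /code_behead; congr (code_drop i _); case: b; lia.
Qed.

Lemma strcode_bit s i : i < size s -> code_bit (strcode s) i = nth false s i.
Proof.
move=> si; rewrite /code_bit strcode_drop (drop_nth false si) /=.
by rewrite oddD odd_double /=; case: (nth _ _ _).
Qed.

Lemma strcode_take s j :
  j <= size s -> mkseq (code_bit (strcode s)) j = take j s.
Proof.
move=> js; apply: (@eq_from_nth _ false).
  by rewrite size_mkseq size_take_min (minn_idPl js).
move=> i; rewrite size_mkseq => ij; rewrite nth_mkseq // nth_take //.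
by apply: strcode_bit; apply: leq_trans js.
Qed.

Lemma strcode_cat s t : strcode (s ++ t) = strcode s + 2 ^ size s * strcode t.
Proof.
elim: s => [|b s IHs] /=; first by rewrite mul1n.
by rewrite IHs expnS -!muln2; lia.
Qed.

Lemma strcode_bounds s : 2 ^ size s <= (strcode s).+1 < 2 ^ (size s).+1.
Proof.
elim: s => [//|b s] /=; rewrite !expnS -muln2.
by move: (2 ^ _) (strcode s) => x y; case: b => /=; lia.
Qed.

Lemma strcode_size s : code_size (strcode s) = size s.
Proof. by apply: trunc_log_eq => //; apply: strcode_bounds. Qed.

Lemma strcode_inj : injective strcode.
Proof.
move=> s t st; rewrite -[s]take_size -[t]take_size -!strcode_take //.
by rewrite -!strcode_size st.
Qed.

Lemma strcode_surj n : exists s, strcode s = n.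
Proof.
elim/ltn_ind: n => -[|n] IHn; first by exists [::].
have [|s ns] := IHn n./2; first by lia.
by exists (odd n :: s) => /=; rewrite ns; lia.
Qed.

Lemma recursive_code_drop k h f :
  recursive k h -> recursive k f ->
  recursive k (fun v => code_drop (h v) (f v)).
Proof.
apply: recursive_iter; apply: recursive_half; apply: recursive_pred.
exact: recursive_nth.
Qed.

Lemma recursive_code_bit k f h :
  recursive k f -> recursive k h -> recursive k (fun v => code_bit (f v) (h v)).
Proof.
move=> rf rh; apply: recursive_negb; apply: recursive_odd.
exact: recursive_code_drop.
Qed.

Lemma recursive_code_size k f :
  recursive k f -> recursive k (fun v => code_size (f v)).
Proof.
apply: recursive1.
(* The logarithm is the least [i] whose next power of two exceeds the successor of the code. *)
apply: (recursive_mu (p := fun i v => (nth 0 v 0).+2 <= 2 ^ i.+1)).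
- apply: recursive_leq.
    apply: recursive_succ; apply: recursive_succ.
    by apply: (@recursive_drop _ 1 (nth 0 ^~ 0)); apply: recursive_nth.
  by apply: recursive_exp2; apply: recursive_succ; apply: recursive_nth.
- by move=> v; apply: trunc_log_ltn.
- move=> v y lt_y; rewrite leqNgt; apply/negP => yk.
  have : 2 ^ y.+1 <= 2 ^ code_size (nth 0 v 0) by rewrite leq_exp2l.
  have /andP[] := trunc_log_bounds (ltnSn 1) (ltn0Sn (nth 0 v 0)).
  by rewrite /code_size; lia.
Qed.

(** * Simulation of programs on finite oracles *)

Section ProgInd.

Variable P : prog -> Prop.
Hypothesis P_Zero : P Zero.
Hypothesis P_Succ : P Succ.
Hypothesis P_Proj : forall i, P (Proj i).
Hypothesis P_Oracle : P Oracle.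
Hypothesis P_Comp : forall f gs,
  P f -> (forall i, i < size gs -> P (nth Zero gs i)) -> P (Comp f gs).
Hypothesis P_PrimRec : forall f g, P f -> P g -> P (PrimRec f g).
Hypothesis P_Mu : forall f, P f -> P (Mu f).

(** [Comp] nests [prog] inside a list; an inner recursion on that list provides the hypotheses for
    its components. *)
Fixpoint prog_nested_ind (c : prog) : P c :=
  match c with
  | Zero => P_Zero
  | Succ => P_Succ
  | Proj i => P_Proj i
  | Oracle => P_Oracle
  | Comp f gs => P_Comp (prog_nested_ind f)
      ((fix all_gs (gs : seq prog) :
           forall i, i < size gs -> P (nth Zero gs i) :=
         match gs with
         | [::] => fun i lt => False_ind _ (notF lt)
         | g :: gs' => fun i =>
           match i with
           | 0 => fun=> prog_nested_ind g
           | i'.+1 => all_gs gs' i'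
           end
         end) gs)
  | PrimRec f g => P_PrimRec (prog_nested_ind f) (prog_nested_ind g)
  | Mu f => P_Mu (prog_nested_ind f)
  end.

End ProgInd.

(* The state of a search among the first [n] arguments for an argument where
   [F] is [1]: [0] while it runs, [1] once it has met a value [0], which stands
   for a failed computation, and [y.+2] once it has found [y]. *)
Definition search (F : nat -> nat) (n : nat) : nat :=
  nat_rec (fun=> nat) 0
    (fun z st => if st == 0 then
       if F z is r.+1 then if r == 0 then z.+2 else 0 else 1
     else st) n.

(* Simulates the program with the finite oracle [s], giving up on queries
   beyond [s] and on searches of more than [size s] steps: the result is [0]
   on failure and [y.+1] for the output [y]. *)
Fixpoint run (c : prog) (s : seq bool) (v : seq nat) : nat :=
  match c with
  | Zero => 1
  | Succ => (nth 0 v 0).+2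
  | Proj i => (nth 0 v i).+1
  | Oracle =>
      if nth 0 v 0 < size s then (nth false s (nth 0 v 0) : nat).+1 else 0
  | Comp f gs =>
      let ws := [seq run g s v | g <- gs] in
      if all (leq 1) ws then run f s [seq w.-1 | w <- ws] else 0
  | PrimRec f g =>
      if v is n :: v' then
        nat_rec (fun=> nat) (run f s v')
          (fun i r => if r is r'.+1 then run g s [:: i, r' & v'] else 0) n
      else 0
  | Mu f => (search (fun z => run f s (z :: v)) (size s)).-1
  end.

Lemma vrecursive_map (A : Type) (h : A -> seq nat -> nat) k (x0 : A) gs :
  (forall i, i < size gs -> recursive k (h (nth x0 gs i))) ->
  vrecursive k (size gs) (fun v => [seq h g v | g <- gs]).
Proof.
elim: gs => [|g gs IHgs] rgs; first exact: vrecursive_nil.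
apply: vrecursive_cons; first exact: (rgs 0).
by apply: IHgs => i; apply: (rgs i.+1).
Qed.

Lemma recursive_all_pos k m H :
  vrecursive k m H -> recursive k (fun v => all (leq 1) (H v)).
Proof.
elim: m H => [|m IHm] H rH.
  apply: (@recursive_ext _ (fun=> 1)); last exact: recursive_const.
  by case: rH => gs _ gsH v /gsH[]; case: (H v).
apply: (@recursive_ext _
  (fun v => (1 <= nth 0 (H v) 0) && all (leq 1) (behead (H v)))).
  by case: rH => gs _ gsH v /gsH[]; case: (H v).
apply: recursive_andb; last by apply: IHm; apply: (vrecursive_behead rH).
apply: recursive_leq; first exact: recursive_const.
exact: vrecursive_nth rH.
Qed.

(** Since [c] is fixed, induction on it builds a program for its simulation. The oracle is given by
    a code and a separate length, so that every prefix of a coded string is available from the same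
    code. *)
Lemma recursive_run c k m K J H :
  recursive k K -> recursive k J -> vrecursive k m H ->
  recursive k (fun v => run c (mkseq (code_bit (K v)) (J v)) (H v)).
Proof.
elim/prog_nested_ind: c k m K J H => /=.
- by move=> *; apply: recursive_const.
- move=> k m K J H rK rJ rH; do 2!apply: recursive_succ.
  exact: vrecursive_nth rH.
- move=> i k m K J H rK rJ rH; apply: recursive_succ.
  exact: vrecursive_nth rH.
- move=> k m K J H rK rJ rH; have rH0 := vrecursive_nth 0 rH.
  apply: (@recursive_ext _ (fun v => if nth 0 (H v) 0 < J v then
                     (code_bit (K v) (nth 0 (H v) 0) : nat).+1 else 0)).
    by move=> v _; rewrite size_mkseq; case: ifP => // lt; rewrite nth_mkseq.
  apply: recursive_if; last exact: recursive_const.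
    by apply: recursive_leq => //; apply: recursive_succ.
  by apply: recursive_succ; apply: recursive_code_bit.
- move=> f gs IHf IHgs k m K J H rK rJ rH.
  have rgs : vrecursive k (size gs)
      (fun v => [seq run g (mkseq (code_bit (K v)) (J v)) (H v) | g <- gs]).
    apply: (vrecursive_map (x0 := Zero)
      (h := fun g v => run g (mkseq (code_bit (K v)) (J v)) (H v))).
    by move=> i lti; apply: (IHgs _ lti _ m).
  apply: recursive_if; last exact: recursive_const.
    exact: recursive_all_pos rgs.
  apply: (IHf k (size gs)) => //; apply: vrecursive_ext.
    by move=> v _; rewrite -map_comp; reflexivity.
  apply: (vrecursive_map (x0 := Zero)
    (h := fun g v => (run g (mkseq (code_bit (K v)) (J v)) (H v)).-1)).
  by move=> i lti; apply: recursive_pred; apply: (IHgs _ lti _ m).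
- move=> f g IHf IHg k [|m] K J H rK rJ rH.
    apply: (@recursive_ext _ (fun=> 0)); last exact: recursive_const.
    by case: rH => gs _ gsH v /gsH[]; case: (H v).
  pose s v := mkseq (code_bit (K v)) (J v).
  apply: (@recursive_ext _ (fun v => nat_rec (fun=> nat)
    (run f (s v) (behead (H v)))
    (fun i r => if r is r'.+1 then run g (s v) [:: i, r' & behead (H v)] else 0)
    (nth 0 (H v) 0))).
    by case: rH => gs _ gsH v /gsH[]; case: (H v).
  have rH' := vrecursive_behead rH.
  apply: (recursive_rec (G := fun i r v =>
    if r is r'.+1 then run g (s v) [:: i, r' & behead (H v)] else 0)).
  + exact: vrecursive_nth rH.
  + exact: (IHf k m).
  apply: (recursive_case (h := nth 0 ^~ 1) (f := fun=> 0) (G := fun r v =>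
    run g (s (drop 2 v)) [:: nth 0 v 0, r & behead (H (drop 2 v))])).
  + exact: recursive_nth.
  + exact: recursive_zero.
  (* The list [w] holds the output at the previous stage, the counter and the raw value of that
     stage, then the parameters; hence the two drops. *)
  apply: (IHg _ m.+2 (fun w => K (drop 2 (drop 1 w)))
                     (fun w => J (drop 2 (drop 1 w)))).
  + by apply: (@recursive_drop _ 1 (fun v => K (drop 2 v)));
      apply: (@recursive_drop _ 2).
  + by apply: (@recursive_drop _ 1 (fun v => J (drop 2 v)));
      apply: (@recursive_drop _ 2).
  apply: vrecursive_cons.
    by apply: (@recursive_drop _ 1 (nth 0 ^~ 0)); apply: recursive_nth.
  apply: vrecursive_cons; first exact: recursive_nth.
  apply: (vrecursive_comp (H := drop 1) (m := k.+2)
    (G := fun v => behead (H (drop 2 v)))).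
    exact: (@vrecursive_drop k.+2 1).
  apply: (vrecursive_comp (H := drop 2) _ rH').
  exact: (@vrecursive_drop k 2).
- move=> f IHf k m K J H rK rJ rH; apply: recursive_pred.
  pose s v := mkseq (code_bit (K v)) (J v).
  (* The length of the oracle bounds the search, so the case of [Mu] is again a primitive
     recursion. *)
  apply: (@recursive_ext _ (fun v => nat_rec (fun=> nat) 0
    (fun z st => if st == 0 then
       if run f (s v) (z :: H v) is r.+1 then if r == 0 then z.+2 else 0 else 1
     else st) (J v))); first by move=> v _; rewrite size_mkseq.
  apply: (recursive_rec (G := fun z st v => if st == 0 then
       if run f (s v) (z :: H v) is r.+1 then if r == 0 then z.+2 else 0 else 1
     else st)) => //; first exact: recursive_zero.
  apply: recursive_if; last exact: recursive_nth.
    by apply: recursive_eq; [apply: recursive_nth | apply: recursive_const].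
  apply: (recursive_case
    (h := fun v => run f (s (drop 2 v)) (nth 0 v 0 :: H (drop 2 v)))
    (f := fun=> 1) (G := fun r v => if r == 0 then (nth 0 v 0).+2 else 0)).
  + apply: (IHf _ m.+1 (fun w => K (drop 2 w)) (fun w => J (drop 2 w))).
    * exact: (@recursive_drop _ 2).
    * exact: (@recursive_drop _ 2).
    apply: vrecursive_cons; first exact: recursive_nth.
    apply: (vrecursive_comp (H := drop 2) (G := H) _ rH).
    exact: (@vrecursive_drop k 2).
  + exact: recursive_const.
  + apply: recursive_if; last exact: recursive_const.
      by apply: recursive_eq; [apply: recursive_nth | apply: recursive_const].
    apply: recursive_succ; apply: recursive_succ.
    by apply: (@recursive_drop _ 1 (nth 0 ^~ 0)); apply: recursive_nth.
Qed.

Lemma search0 F n : search F n = 0 -> forall z, z < n -> 1 < F z.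
Proof.
elim: n => // n IHn /=; case: eqP => // /IHn{}IHn.
case Fn: (F n) => [//|[//|r]] _ z; rewrite ltnS leq_eqVlt => /orP[/eqP->|].
  by rewrite Fn.
exact: IHn.
Qed.

Lemma search_sound F n y :
  search F n = y.+2 -> F y = 1 /\ (forall z, z < y -> 1 < F z).
Proof.
elim: n => // n IHn /=; case: eqP => // /search0 sF.
by case Fn: (F n) => [//|[|//]] [<-].
Qed.

Lemma search_running F n : (forall z, z < n -> 1 < F z) -> search F n = 0.
Proof.
elim: n => // n IHn Fz /=; rewrite -/(search F n) IHn; last first.
  by move=> z zn; apply: Fz; lia.
by case: (F n) (Fz n (ltnSn n)) => [|[]].
Qed.

Lemma search_complete F n y :
  F y = 1 -> (forall z, z < y -> 1 < F z) -> y < n -> search F n = y.+2.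
Proof.
move=> Fy Fz; elim: n => // n IHn; rewrite ltnS leq_eqVlt => /orP[/eqP<-|/IHn].
  by rewrite /= -/(search F y) search_running //= Fy.
by rewrite /= -/(search F n) => ->.
Qed.

Lemma run_sound X c n v y :
  run c (mkseq X n) v = y.+1 -> eval X c v y.
Proof.
elim/prog_nested_ind: c v y => /=.
- by move=> v y [<-]; apply: eval_zero.
- by move=> v y [<-]; apply: eval_succ.
- by move=> i v y [<-]; apply: eval_proj.
- move=> v y; rewrite size_mkseq; case: ifP => // vn; rewrite nth_mkseq //.
  by move=> [<-]; apply: eval_oracle.
- move=> f gs IHf IHgs v y; case: ifP => // /all_nthP pos /IHf.
  apply: eval_comp; first by rewrite !size_map.
  move=> i lti; apply: IHgs => //; rewrite (nth_map 0) ?size_map //.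
  rewrite (nth_map Zero) // prednK //.
  by have := pos 0 i; rewrite size_map (nth_map Zero) //; apply.
- move=> f g IHf IHg [//|n' v] y; elim: n' y => [|n' IHn] y /=.
    by move/IHf; apply: eval_rec0.
  by case: (nat_rec _ _ _ _) IHn => // r /(_ r erefl) ev /IHg; apply: eval_recS.
- move=> f IHf v y; case sE: (search _ _) => [|[|y']] //= -[<-].
  have [fy fz] := search_sound sE.
  (* A result of [run] above [1] stands for a positive output; subtracting [2] yields the
     predecessor of that output. *)
  apply: (@eval_mu _ _ _ _ (fun z => (run f (mkseq X n) (z :: v)).-2)).
    by move=> z /fz lt1; apply: IHf; lia.
  exact: IHf.
Qed.

(** Finitely many thresholds have a maximum. This serves the components of a [Comp] and the
    unsuccessful steps of a [Mu]. *)
Lemma eventually_bounded (P : nat -> nat -> Prop) m :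
  (forall i, i < m -> exists N, forall n, N <= n -> P i n) ->
  exists N, forall n, N <= n -> forall i, i < m -> P i n.
Proof.
elim: m => [|m IHm] ev; first by exists 0.
have [|N1 P1] := IHm; first by move=> i im; apply: ev; lia.
have [N2 P2] := ev m (ltnSn m); exists (maxn N1 N2) => n Nn i.
rewrite ltnS leq_eqVlt => /orP[/eqP->|]; first by apply: P2; lia.
by apply: P1; lia.
Qed.

(** A halting computation asks finitely many queries and makes finitely many search steps. Asking
    for success at all large [n] lets the thresholds of subcomputations be combined by maxima. *)
Lemma run_complete X c v y :
  eval X c v y ->
  exists N, forall n, N <= n -> run c (mkseq X n) v = y.+1.
Proof.
elim=> {c v y}.
- by exists 0.
- by exists 0.
- by exists 0.
- move=> v; exists (nth 0 v 0).+1 => n vn /=.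
  by rewrite size_mkseq vn nth_mkseq.
- move=> f gs v ws y sws _ /eventually_bounded[N1 P1] _ [N2 P2].
  exists (maxn N1 N2) => n Nn /=.
  have -> : [seq run g (mkseq X n) v | g <- gs] = [seq w.+1 | w <- ws].
    apply: (@eq_from_nth _ 0); rewrite !size_map // => i lti.
    by rewrite (nth_map Zero) // (nth_map 0) ?sws // P1 //; lia.
  by rewrite all_map all_predT -map_comp map_id P2 //; lia.
- by move=> f g v y _ [N PN]; exists N.
- move=> f g i v r y _ [N1 P1] _ [N2 P2]; exists (maxn N1 N2) => n Nn /=.
  by have /= -> := P1 n _; rewrite ?P2 //; lia.
- move=> f v y w _ /eventually_bounded[N1 P1] _ [N2 P2].
  (* The bound [y.+1] lets the search reach [y]. *)
  exists (maxn y.+1 (maxn N1 N2)) => n Nn /=.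
  rewrite (@search_complete _ _ y) // ?size_mkseq; try lia.
    by apply: P2; lia.
  by move=> z zy; rewrite P1 //; lia.
Qed.

(** * Elements of the computed set found on a finite oracle *)

(* The value [2] of [run] stands for the output [1], that is, membership. *)
Definition hit c (s : seq bool) x : bool :=
  has (fun j => has (fun m => (x <= m) && (run c (take j s) [:: m] == 2))
                    (iota 0 j)) (iota 0 (size s).+1).

Definition hit_code c k x n : bool :=
  has (fun j => has (fun m => (x <= m) &&
                       (run c (mkseq (code_bit k) j) [:: m] == 2))
                    (iota 0 j)) (iota 0 n.+1).

Lemma strcode_hit c s x : hit_code c (strcode s) x (size s) = hit c s x.
Proof.
apply: eq_in_has => j; rewrite mem_iota add0n /= ltnS => js.
by apply: eq_has => m; rewrite strcode_take.
Qed.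

Lemma recursive_hit_code c k K x n :
  recursive k K -> recursive k x -> recursive k n ->
  recursive k (fun v => hit_code c (K v) (x v) (n v)).
Proof.
apply: (recursive3 (F := hit_code c)).
apply: (recursive_has (p := fun j v => has (fun m => (nth 0 v 1 <= m) &&
   (run c (mkseq (code_bit (nth 0 v 0)) j) [:: m] == 2)) (iota 0 j))).
  apply: (recursive_has (p := fun m v => (nth 0 (drop 1 v) 1 <= m) &&
    (run c (mkseq (code_bit (nth 0 (drop 1 v) 0)) (nth 0 v 0)) [:: m] == 2)));
    last exact: recursive_nth.
  apply: (@recursive_ext _ (fun v => (nth 0 v 3 <= nth 0 v 0) &&
    (run c (mkseq (code_bit (nth 0 v 2)) (nth 0 v 1)) [:: nth 0 v 0] == 2))).
    by move=> v _; rewrite !nth_drop.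
  apply: recursive_andb; first by apply: recursive_leq; apply: recursive_nth.
  apply: recursive_eq; last exact: recursive_const.
  apply: (recursive_run c (m := 1)); try exact: recursive_nth.
  by apply: vrecursive_cons; [apply: recursive_nth | apply: vrecursive_nil].
by apply: recursive_succ; apply: recursive_nth.
Qed.

(** As [hit] tries every prefix [take j s] as oracle, it persists under extension whatever [run]
    does on longer oracles. *)
Lemma hit_cat c s t x : hit c s x -> hit c (s ++ t) x.
Proof.
move=> /hasP[j]; rewrite mem_iota add0n /= ltnS => js hj.
apply/hasP; exists j; first by rewrite mem_iota size_cat; lia.
by rewrite takel_cat.
Qed.

Lemma take_mkseq (T : Type) (f : nat -> T) j n :
  j <= n -> take j (mkseq f n) = mkseq f j.
Proof. by move=> jn; rewrite /mkseq -map_take take_iota (minn_idPl jn). Qed.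

(** On a long enough prefix of [A], the function [run] returns both outputs. *)
Lemma eval_fun A c v y y' : eval A c v y -> eval A c v y' -> y = y'.
Proof.
move=> /run_complete[N PN] /run_complete[N' PN'].
by have := PN (maxn N N'); rewrite PN' ?leq_maxr // leq_maxl => /(_ isT)[].
Qed.

(** * Consequences of 2-genericity for a program computing an infinite set *)

Section Functional.

Variables (X I : nat -> bool) (c : prog).
Hypothesis XI : forall n, eval X c [:: n] (I n).

(** A successful simulation on a prefix of [X] is a true computation, whose output can only be
    [I m]. The bound [m < n] will place the element inside a block. *)
Lemma hit_sound n x : hit c (mkseq X n) x -> exists2 m, I m & x <= m < n.
Proof.
move=> /hasP[j]; rewrite mem_iota add0n /= size_mkseq ltnS => jn.
rewrite take_mkseq // => /hasP[m]; rewrite mem_iota add0n /= => mj.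
move=> /andP[xm /eqP/run_sound/(eval_fun (XI m))]; case Im: (I m) => // _.
by exists m; lia.
Qed.

Lemma hit_complete x m :
  I m -> x <= m -> exists N, forall n, N <= n -> hit c (mkseq X n) x.
Proof.
move=> Im xm; have [N PN] := run_complete (XI m).
exists (maxn N m.+1) => n Nn; apply/hasP; exists n.
  by rewrite size_mkseq mem_iota; lia.
rewrite take_mkseq //; apply/hasP; exists m; first by rewrite mem_iota; lia.
by rewrite xm PN ?Im //; lia.
Qed.

Lemma two_generic_hit :
  two_generic X -> infinite_set [set n | I n] ->
  exists n0, forall u x, exists t, hit c (mkseq X n0 ++ u ++ t) x.
Proof.
move=> gX Iinf.
(* For [a] and [y] coding [s] and [t], the first argument of [hit_code] is the code of [s ++ t], by
   [strcode_cat], and the last is its length. *)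
pose R a x y := ~~ hit_code c (a + 2 ^ code_size a * y) x
                              (code_size a + code_size y).
have [|n0 [[x Sx]|noS]] :=
    gX [set s | exists x, forall t, ~~ hit c (s ++ t) x].
- exists R.
    have [p pR] : recursive 3 (fun v => R (nth 0 v 0) (nth 0 v 1) (nth 0 v 2)).
      apply: recursive_negb; apply: recursive_hit_code.
      + apply: recursive_add; first exact: recursive_nth.
        apply: recursive_mul; last exact: recursive_nth.
        apply: recursive_exp2; apply: recursive_code_size.
        exact: recursive_nth.
      + exact: recursive_nth.
      + by apply: recursive_add; apply: recursive_code_size;
          apply: recursive_nth.
    by exists p => a x y; apply: (pR [:: a; x; y]).
  have RE s x t : R (strcode s) x (strcode t) = ~~ hit c (s ++ t) x.
    by rewrite /R !strcode_size -strcode_cat -size_cat strcode_hit.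
  move=> s; split=> -[x Hx]; exists x => y; last by rewrite -RE.
  by have [t <-] := strcode_surj y; rewrite RE.
- have [m /= Im xm] : exists2 m, I m & x <= m.
    apply: contrapT => noI; apply: Iinf; apply: sub_finite_set (finite_II x).
    by move=> m /= Im; rewrite ltnNge; apply/negP => xm; apply: noI; exists m.
  have [N PN] := hit_complete Im xm.
  (* The refuting extension is the next piece of [X] itself, long enough to reveal the element [m]
     of [I]. *)
  have /negP[] := Sx (drop n0 (mkseq X (maxn N n0))).
  rewrite -[mkseq X n0](@take_mkseq _ X n0 (maxn N n0)) ?leq_maxr //.
  by rewrite cat_take_drop PN ?leq_maxl.
- exists n0 => u x; apply: contrapT => noT.
  apply: (noS (mkseq X n0 ++ u)); first exact: prefix_prefix.
  exists x => t; apply/negP => ht; apply: noT; exists t.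
  by rewrite catA.
Qed.

End Functional.

(** * The computable sequence of blocks and its dense c.e. set *)

Section Blocks.

Variables (c : prog) (s0 : seq bool).
Hypothesis hit_dense : forall u x, exists t, hit c (s0 ++ u ++ t) x.

Lemma exists_block l :
  exists t, forall u, size u = l -> hit c (s0 ++ u ++ t) (size s0 + l).
Proof.
have [t Pt] : exists t, forall u,
    u \in [seq val w | w <- enum {: l.-tuple bool}] ->
    hit c (s0 ++ u ++ t) (size s0 + l).
  elim: [seq val w | w <- _] => [|u us [t Pt]]; first by exists [::].
  have [t' ht'] := hit_dense (u ++ t) (size s0 + l).
  exists (t ++ t') => w; rewrite inE => /orP[/eqP->|/Pt hw].
    by rewrite !catA -!catA in ht' *.
  (* Lengthening [t] for one more [u] keeps the hits already obtained. *)
  by have := hit_cat t' hw; rewrite -!catA.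
exists t => u su; apply: Pt; apply/mapP; exists (tcast su (in_tuple u)).
  by rewrite mem_enum.
by rewrite /= val_tcast.
Qed.

(** The number [(a + 2 ^ l).-1] is the code of the string of index [a] among those of length [l], so
    a bounded quantifier over [a] runs through all [u] of that length. *)
Definition good l b : bool :=
  all (fun a => hit_code c
         (strcode s0 + 2 ^ size s0 * ((a + 2 ^ l).-1 + 2 ^ l * b))
         (size s0 + l) (size s0 + (l + code_size b))) (iota 0 (2 ^ l)).

(* The strings of length [l] are those with codes from [2 ^ l - 1] up to but
   excluding [2 ^ l.+1 - 1]. *)
Lemma goodP l t :
  reflect (forall u, size u = l -> hit c (s0 ++ u ++ t) (size s0 + l))
          (good l (strcode t)).
Proof.
have codeE u : size u = l -> strcode s0 + 2 ^ size s0 *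
    (strcode u + 2 ^ l * strcode t) = strcode (s0 ++ u ++ t).
  by move=> <-; rewrite !strcode_cat.
have sizeE u : size u = l ->
    size s0 + (l + code_size (strcode t)) = size (s0 ++ u ++ t).
  by move=> <-; rewrite !size_cat strcode_size.
apply: (iffP allP) => [all_a u su | all_u a].
  have := strcode_bounds u; rewrite su expnS => bu.
  have := all_a ((strcode u).+1 - 2 ^ l).
  rewrite mem_iota subnK; last by lia.
  by rewrite codeE // (sizeE u) // strcode_hit; apply; lia.
rewrite mem_iota add0n /= => al; have [u ua] := strcode_surj (a + 2 ^ l).-1.
have su : size u = l.
  rewrite -strcode_size ua; apply: trunc_log_eq => //; rewrite expnS.
  by rewrite prednK; lia.
by rewrite -ua codeE // (sizeE u) // strcode_hit; apply: all_u.
Qed.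

Lemma exists_good l : exists b, good l b.
Proof. by have [t /goodP] := exists_block l; exists (strcode t). Qed.

(** Choosing the least good code makes the block string computable by an unbounded search. *)
Definition block_code l := ex_minn (exists_good l).

Lemma block_code_good l : good l (block_code l).
Proof. by rewrite /block_code; case: ex_minnP. Qed.

Lemma recursive_block_code k f :
  recursive k f -> recursive k (fun v => block_code (f v)).
Proof.
apply: recursive1; apply: (recursive_mu (p := fun b v => good (nth 0 v 0) b)).
- have rl : recursive 2 (fun v => nth 0 (drop 1 v) 0).
    by apply: (@recursive_drop _ 1 (nth 0 ^~ 0)); apply: recursive_nth.
  have r2l := recursive_exp2 rl.
  apply: (recursive_all (p := fun a v => hit_code c
    (strcode s0 + 2 ^ size s0 * ((a + 2 ^ nth 0 (drop 1 v) 0).-1 +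
       2 ^ nth 0 (drop 1 v) 0 * nth 0 v 0))
    (size s0 + nth 0 (drop 1 v) 0)
    (size s0 + (nth 0 (drop 1 v) 0 + code_size (nth 0 v 0))))) => //.
  (* Under the bounded quantifier [a] comes first, which shifts [b] and [l] by one place. *)
  have {}rl := @recursive_drop _ 1 _ rl.
  have {}r2l := @recursive_drop _ 1 _ r2l.
  have rb : recursive 3 (fun v => nth 0 (drop 1 v) 0).
    by apply: (@recursive_drop _ 1 (nth 0 ^~ 0)); apply: recursive_nth.
  apply: recursive_hit_code.
  + apply: recursive_add; first exact: recursive_const.
    apply: recursive_mul; first exact: recursive_const.
    apply: recursive_add; last exact: recursive_mul.
    by apply: recursive_pred; apply: recursive_add => //; apply: recursive_nth.
  + by apply: recursive_add => //; apply: recursive_const.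
  + apply: recursive_add; first exact: recursive_const.
    by apply: recursive_add => //; apply: recursive_code_size.
- by move=> v; apply: block_code_good.
- by move=> v y; rewrite /block_code; case: ex_minnP => m _; apply.
Qed.

(** Positions are counted from the end of [s0]. *)
Definition block_start i := iter i (fun l => l + code_size (block_code l)) 0.

Lemma recursive_block_start k h :
  recursive k h -> recursive k (fun v => block_start (h v)).
Proof.
move=> rh; apply: recursive_iter => //; last exact: recursive_const.
apply: recursive_add; first exact: recursive_nth.
apply: recursive_code_size; apply: recursive_block_code; exact: recursive_nth.
Qed.

(** A block string is nonempty: a hit with bound [size s0 + l] needs an [m] at or above this bound
    and below the length of the whole string. Any [u] of length [l] shows it, here the constant
    one. *)
Lemma block_start_lt i : block_start i < block_start i.+1.
Proof.
rewrite [in X in _ < X]/block_start /= -/(block_start i).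
have := block_code_good (block_start i).
have [t <-] := strcode_surj (block_code (block_start i)).
move=> /goodP/(_ (nseq (block_start i) false) (size_nseq _ _)).
rewrite strcode_size => /hasP[j]; rewrite mem_iota !size_cat size_nseq => js.
by case/hasP => m; rewrite mem_iota => mj /andP[]; lia.
Qed.

Lemma block_start_le i j : i <= j -> block_start i <= block_start j.
Proof.
elim: j => [|j IHj]; first by rewrite leqn0 => /eqP->.
rewrite leq_eqVlt => /orP[/eqP->//|/IHj le].
exact: leq_trans le (ltnW (block_start_lt j)).
Qed.

Lemma block_start_ge i : i <= block_start i.
Proof. by elim: i => // i IHi; apply: leq_ltn_trans (block_start_lt i). Qed.

Lemma block_index_inj i j n :
  block_start i <= n < block_start i.+1 ->
  block_start j <= n < block_start j.+1 -> i = j.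
Proof.
move=> ni nj; case: (ltngtP i j) => // /block_start_le; lia.
Qed.

Definition blocks : set (seq bool) :=
  [set s | exists i, code_drop (size s0 + block_start i) (strcode s) =
                     block_code (block_start i)].

Lemma ce_blocks : ce blocks.
Proof.
(* The program tests failure of the index, so that [Mu p] halts exactly on the codes of members of
   [blocks]. *)
have [p ep] : recursive 2 (fun v =>
    code_drop (size s0 + block_start (nth 0 v 0)) (nth 0 v 1)
    != block_code (block_start (nth 0 v 0))).
  have rs : recursive 2 (fun v => block_start (nth 0 v 0)).
    by apply: recursive_block_start; apply: recursive_nth.
  apply: recursive_negb; apply: recursive_eq; last exact: recursive_block_code.
  apply: recursive_code_drop; last exact: recursive_nth.
  by apply: recursive_add => //; apply: recursive_const.
pose q i s := code_drop (size s0 + block_start i) (strcode s)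
              != block_code (block_start i).
have {}ep i s : eval (fun=> false) p [:: i; strcode s] (q i s).
  exact: (ep [:: i; strcode s]).
exists (Mu p) => s; split=> [exi | [y ev]].
  have exq : exists i, ~~ q i s.
    by case: exi => i si; exists i; rewrite negbK; apply/eqP.
  exists (ex_minn exq); case: ex_minnP => i qi imin.
  apply: (@eval_mu _ _ _ _ (fun=> 0)) => [z zi|].
    by have := ep z s; case qz: (q z s) => //; have := imin z; rewrite qz; lia.
  by have := ep i s; rewrite (negbTE qi).
inversion ev as [| | | | | | |f v y' w _ ev0]; subst.
exists y; have := eval_fun ev0 (ep y s).
by rewrite /q; case: eqP.
Qed.

Lemma dense_blocks : dense_strings blocks.
Proof.
(* The block of index [size s] starts no earlier than the end of [s], by [block_start_ge]; the gap
   is padded with [false]. *)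
move=> s; pose l := size s0 + block_start (size s).
have [t tE] := strcode_surj (block_code (block_start (size s))).
have sl : size s <= l by rewrite /l; have := block_start_ge (size s); lia.
exists (s ++ nseq (l - size s) false ++ t); first exact: prefix_prefix.
exists (size s); rewrite strcode_drop -/l catA drop_size_cat ?tE //.
by rewrite size_cat size_nseq subnKC.
Qed.

End Blocks.

(** * The set [Y] and the contradiction *)

Theorem mainTheorem13 (X : nat -> bool) (hX : two_generic X) :
  ~ (exists I : nat -> bool,
       [/\ computes X I, infinite_set [set n | I n] & indifferent_w1g I X]).
Proof.
move=> [I [[c XI] Iinf indI]].
have [n0 hd] := two_generic_hit XI hX Iinf.
set s0 := mkseq X n0 in hd; have s0n : size s0 = n0 by rewrite size_mkseq.
pose L := block_start hd; pose B := block_code hd.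
(* [Z] spells out all block strings at their positions and is [false] before [n0]. *)
pose Z n := `[< exists2 i, n0 + L i <= n < n0 + L i.+1 &
                           code_bit (B (L i)) (n - (n0 + L i)) >].
pose Y n := if I n then ~~ Z n else X n.
have [|N [i]] := indI Y _ (blocks hd) (ce_blocks hd) (dense_blocks hd).
  by move=> n /negbTE In; rewrite /Y In.
rewrite strcode_drop s0n -/L -/B; set l := n0 + L i.
have [t tE] := strcode_surj (B (L i)); rewrite -tE => /strcode_inj Yt.
have LS : L i.+1 = L i + size t.
  rewrite /L /block_start /= -/(block_start hd i) -/L -/(B _) -tE.
  by rewrite strcode_size.
have Lt : L i < L i.+1 by apply: block_start_lt.
(* The block is nonempty by [Lt], so the truncated difference [N - l] is a genuine one. *)
have NE : N = l + size t.
  by have := congr1 size Yt; rewrite size_drop size_mkseq; lia.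
have Yp p : p < size t -> Y (l + p) = nth false t p.
  by move=> pt; rewrite -Yt nth_drop nth_mkseq // NE; lia.
have Zp p : p < size t -> Z (l + p) = nth false t p.
  move=> pt; have Zi : n0 + L i <= l + p < n0 + L i.+1 by lia.
  have bE : code_bit (B (L i)) (l + p - (n0 + L i)) = nth false t p.
    by rewrite addKn -tE strcode_bit.
  (* Blocks are disjoint, so the index [j] witnessing [Z] at this position must be [i]. *)
  apply/asboolP/idP => [[j Zj] | tp]; last by exists i => //; rewrite bE.
  suff -> : j = i by rewrite bE.
  by apply: (@block_index_inj _ _ hd _ _ (L i + p)); rewrite -/L; lia.
have In p : p < size t -> I (l + p) = false.
  by move=> pt; have := Yp p pt; rewrite /Y Zp //; case: (I _) => //; case: nth.
(* The piece of [X] between [s0] and the block is one of the strings [u] for which the block string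
   was built. *)
have Xt : mkseq X (l + size t) = s0 ++ drop n0 (mkseq X l) ++ t.
  rewrite catA /s0 -(@take_mkseq _ X n0 l) ?leq_addr // cat_take_drop.
  apply: (@eq_from_nth _ false); first by rewrite size_cat !size_mkseq.
  move=> p; rewrite size_mkseq => pl; rewrite nth_mkseq // nth_cat size_mkseq.
  case: ltnP => lp; first by rewrite nth_mkseq.
  have pt : p - l < size t by lia.
  by have := Yp _ pt; rewrite /Y In // subnKC.
have := block_code_good hd (L i); rewrite -/B -tE => /goodP.
move=> /(_ (drop n0 (mkseq X l))); rewrite -Xt size_drop size_mkseq addKn s0n.
move=> /(_ erefl)/(hit_sound XI)[m Im ml].
have := In (m - l); rewrite subnKC ?Im; last by case/andP: ml.
by move=> /(_ _)/negP[]; lia.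
Qed.
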